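(* Let $L \colon \mathbf{C}[X,X^{-1}] \to \mathbf{C}$ be a non-trivial (i.e. $L \neq 0$), non-injective $\mathbf{C}$-linear map for which there exists an integer $N\geq 1$ such that $L(X^n) = 0$ for all $n\in \mathbf{Z}$ with $n \geq N$ and all $n\in \mathbf{Z}$ with $n \leq -N$. Then $\operatorname{Ker} L$ is an MZ-space of $\mathbf{C}[X,X^{-1}]$ if and only if $L(1)\neq 0$.
   Context: $\mathbf{C}$ is the field of complex numbers, $\mathbf{Z}$ the ring of integers, and $\mathbf{C}[X,X^{-1}]$ the algebra of Laurent polynomials in one variable. Rings are commutative with identity; algebras are unital and associative. Let $R$ be a ring and $A$ an $R$-algebra. For a subset $M \subset A$, the radical of $M$ is $r(M) = \{ a \in A \mid \exists N_0 \geq 1\ \forall m \geq N_0 : a^m \in M\}$, and the strong radical of $M$ is $sr(M) = \{ a \in A \mid \forall b \in A\ \exists N_0 \geq 1\ \forall m \geq N_0 : b a^m \in M\}$ (here $N_0$ may depend on $a$ and $b$). An $R$-submodule $M$ of $A$ is called a Mathieu-Zhao space (MZ-space) of $A$ if $sr(M) = r(M)$. Here $R = \mathbf{C}$ and $A = \mathbf{C}[X,X^{-1}]$. *)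

(* Defs.v *)
(* Over `R : realType`, the field of complex numbers is `R[i]`. *)
From HB Require Import structures.
From mathcomp Require Import all_boot all_order all_algebra finmap.
From mathcomp Require Import monalg.
From mathcomp Require Import complex.
From mathcomp Require Import boolp classical_sets reals.

Set Implicit Arguments.
Unset Strict Implicit.
Unset Printing Implicit Defensive.

Import GRing.Theory.
Local Open Scope ring_scope.
Local Open Scope classical_set_scope.

Definition radical (R : comPzRingType) (A : algType R) (M : set A) : set A :=
  [set a | exists2 N0 : nat,
     (1 <= N0)%N & forall m : nat, (N0 <= m)%N -> M (a ^+ m)].

Definition strong_radical (R : comPzRingType) (A : algType R) (M : set A) :
    set A :=
  [set a | forall b : A, exists2 N0 : nat,
     (1 <= N0)%N & forall m : nat, (N0 <= m)%N -> M (b * a ^+ m)].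

Definition MZ_space (R : comPzRingType) (A : algType R) (M : set A) : Prop :=
  submod_closed [in M] /\ strong_radical M = radical M.

(* The underlying module is that of finitely supported functions `int -> R`.
   The multiplication of `{malg R[K]}` is not available for `K := int`, since
   it requires `x * y = 1 -> x = 1 /\ y = 1` in the monoid `K`; hence the
   alias, which carries the convolution product. *)
Definition laurent (R : comNzRingType) : Type := {malg R[int]}.

Section LaurentRing.
Local Open Scope fset_scope.
Variable R : comNzRingType.
Implicit Types (f g h : {malg R[int]}) (c : R) (k l n : int).

HB.instance Definition _ := GRing.Lmodule.on (laurent R).

Definition laurentXn (n : int) : laurent R := << 1 *g n >>.

Definition laurent_mul f g : {malg R[int]} :=
  \sum_(k <- msupp f) \sum_(l <- msupp g) << f@_k * g@_l *g (k + l)%R >>.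

Lemma laurent_mulw (d e : {fset int}) f g :
  msupp f `<=` d -> msupp g `<=` e ->
  laurent_mul f g =
  \sum_(k <- d) \sum_(l <- e) << f@_k * g@_l *g (k + l)%R >>.
Proof.
move=> led lee; rewrite /laurent_mul (big_fset_incl _ led) /=.
  apply/eq_bigr=> k _; apply/big_fset_incl => // l _ /mcoeff_outdom ->.
  by rewrite mulr0 monalgU0.
move=> k _ /mcoeff_outdom fk.
by rewrite big1 => // l _; rewrite fk mul0r monalgU0.
Qed.

Lemma laurent_mulC : commutative laurent_mul.
Proof.
move=> f g; rewrite /laurent_mul exchange_big /=.
by apply/eq_bigr=> k _; apply/eq_bigr=> l _; rewrite mulrC addrC.
Qed.

Lemma laurent_mulDl : left_distributive laurent_mul +%R.
Proof.
move=> f g h.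
rewrite (laurent_mulw (msuppD_le f g) (fsubset_refl _)).
rewrite (laurent_mulw (fsubsetUl (msupp f) (msupp g)) (fsubset_refl _)).
rewrite (laurent_mulw (fsubsetUr (msupp f) (msupp g)) (fsubset_refl _)).
rewrite -big_split /=; apply/eq_bigr=> k _.
rewrite -big_split /=; apply/eq_bigr=> l _.
by rewrite mcoeffD mulrDl monalgUD.
Qed.

Lemma laurent_mulDr : right_distributive laurent_mul +%R.
Proof.
by move=> f g h; rewrite laurent_mulC laurent_mulDl !(laurent_mulC f).
Qed.

Lemma laurent_mul0l : left_zero 0 laurent_mul.
Proof. by move=> f; rewrite /laurent_mul msupp0 big_seq_fset0. Qed.

Lemma laurent_mul0r : right_zero 0 laurent_mul.
Proof. by move=> f; rewrite laurent_mulC laurent_mul0l. Qed.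

Lemma laurent_mulUU c d k l :
  laurent_mul << c *g k >> << d *g l >> = << c * d *g (k + l)%R >>.
Proof.
by rewrite (laurent_mulw msuppU_le msuppU_le) !big_seq_fset1 !mcoeffUU.
Qed.

Lemma laurent_mul_suml (I : Type) (s : seq I) (F : I -> {malg R[int]}) g :
  laurent_mul (\sum_(i <- s) F i) g = \sum_(i <- s) laurent_mul (F i) g.
Proof.
exact: (big_morph (laurent_mul^~ g) (fun _ _ => laurent_mulDl _ _ _)
  (laurent_mul0l _)).
Qed.

Lemma laurent_mul_sumr (I : Type) (s : seq I) (F : I -> {malg R[int]}) g :
  laurent_mul g (\sum_(i <- s) F i) = \sum_(i <- s) laurent_mul g (F i).
Proof.
exact: (big_morph (laurent_mul g) (fun _ _ => laurent_mulDr _ _ _)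
  (laurent_mul0r _)).
Qed.

Lemma laurent_mulA : associative laurent_mul.
Proof.
move=> f g h.
rewrite (monalgE f) !laurent_mul_suml; apply/eq_bigr=> i _.
rewrite (monalgE g) laurent_mul_suml !laurent_mul_sumr laurent_mul_suml.
apply/eq_bigr=> j _.
rewrite (monalgE h) !laurent_mul_sumr; apply/eq_bigr=> k _.
by rewrite !laurent_mulUU mulrA addrA.
Qed.

Lemma laurent_mul1l : left_id (laurentXn 0) laurent_mul.
Proof.
move=> f; rewrite {1}(monalgE f) laurent_mul_sumr [RHS]monalgE.
by apply/eq_bigr=> k _; rewrite laurent_mulUU mul1r add0r.
Qed.

Lemma laurent_oner_neq0 : laurentXn 0 != 0.
Proof. by rewrite /laurentXn monalgU_eq0 oner_eq0. Qed.

HB.instance Definition _ := GRing.Zmodule_isComNzRing.Build (laurent R)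
  laurent_mulA laurent_mulC laurent_mul1l laurent_mulDl laurent_oner_neq0.

Lemma laurent_scaleE c f : c *: f = laurent_mul << c *g 0 >> f.
Proof.
rewrite {2}(monalgE f) laurent_mul_sumr.
rewrite malgZ_def; apply/eq_bigr=> k _.
by rewrite laurent_mulUU add0r.
Qed.

Fact laurent_scaleAl (c : R) (f g : laurent R) : c *: (f * g) = (c *: f) * g.
Proof.
rewrite [LHS]laurent_scaleE [LHS](laurent_mulA _ f g).
by congr laurent_mul; rewrite -laurent_scaleE.
Qed.

HB.instance Definition _ :=
  GRing.Lmodule_isLalgebra.Build R (laurent R) laurent_scaleAl.

HB.instance Definition _ := GRing.Lalgebra_isComAlgebra.Build R (laurent R).

Lemma laurentXn0 : laurentXn 0 = 1.
Proof. by []. Qed.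

Lemma laurentXnD m n : laurentXn (m + n) = laurentXn m * laurentXn n.
Proof. by rewrite [RHS]laurent_mulUU mul1r. Qed.

(* The monomials form a basis. *)
Lemma laurentE (f : laurent R) :
  f = \sum_(n <- msupp f) (f : {malg R[int]})@_n *: laurentXn n.
Proof.
rewrite {1}(monalgE f); apply/eq_bigr=> n _.
by apply/malgP=> k; rewrite mcoeffZ !mcoeffU mulrnAr mulr1.
Qed.

End LaurentRing.

Notation "''X^[' n ]" := (laurentXn _ n)
  (at level 0, n at level 200, format "''X^[' n ]") : ring_scope.

(* Main.v *)
Require Import Defs.
From mathcomp Require Import all_boot all_order all_fingroup all_algebra.
From mathcomp Require Import complex boolp classical_sets reals.
From mathcomp Require Import mpoly ring zify.

(* A non-zero Laurent polynomial is [X^-r p] with [p 0 <> 0], and [L] reads off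
   one coefficient: [L (X^-e q)] is the coefficient of [symbol * q] of index
   [N + e], where the coefficient of index [N] of [symbol] is [L 1].  If [r] is
   negative or exceeds [deg p], the support of [b f^m] escapes to infinity with
   [m] and [f] is in the strong radical.  Otherwise [L (f^m) = 0] for all large
   [m] must be shown to force [L 1 = 0], an extension of the one-variable
   Duistermaat-van der Kallen theorem.

   If [r = 0] or [r = deg p], expand [(X^r - c p)^K] for a suitable [c].  If
   [0 < r < deg p], replace [f] by a power to get [N < r] and [L (f^m) = 0] for
   [m >= 1].  For large [lam], the geometric series of [f / lam] and Lagrange
   interpolation turn the vanishing into
     [- L 1 / lam = sum of z^(r-1-N) G(z) / P'(z)],
   over the roots [z] of [P = p - lam X^r] in the unit disc, where [G] is
   [symbol].  Multiplying by [lam D(lam)] for a suitable polynomial [D] with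
   [D 0 <> 0] makes each summand a polynomial in [lam] and [z] that vanishes at
   [lam = 0].  The product, over all subsets of roots, of the differences
   between the two sides is symmetric in the roots, hence a polynomial in
   [lam]; it vanishes for infinitely many [lam], and its value at [lam = 0] is
   a power of [- L 1 * D 0]. *)

Import Order.TTheory GRing.Theory Num.Theory.
Local Open Scope ring_scope.
Local Open Scope classical_set_scope.

Set Implicit Arguments.
Unset Strict Implicit.
Unset Printing Implicit Defensive.

(** * Coefficients of a quotient by a linear factor *)

Lemma mulXsubC_coef (F : comNzRingType) (A B : {poly F}) (z : F) (j : nat) :
  ('X - z%:P) * B = A -> A`_j = (if j is j'.+1 then B`_j' else 0) - z * B`_j.
Proof. by move=> <-; rewrite mulrBl coefB coefXM coefCM; case: j. Qed.

(** The recurrence [mulXsubC_coef] is unwound downwards from index [e + n], where the coefficients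
    of [B] vanish. *)
Lemma coef_divXsubC_high (F : comNzRingType) (A B : {poly F}) (z : F)
    (e n : nat) : ('X - z%:P) * B = A -> (size B <= e + n)%N ->
  B`_e = \sum_(j < n) A`_(e.+1 + j) * z ^+ j.
Proof.
move=> BA; elim: n e => [|n IHn] e sB.
  by rewrite big_ord0 nth_default // -[e]addn0.
rewrite big_ord_recl /= addn0 expr0 mulr1 (mulXsubC_coef _ BA).
under eq_bigr => j _ do rewrite /bump /= addnA addn1 exprS mulrCA.
by rewrite -mulr_sumr -IHn ?addSnnS // subrK.
Qed.

(** The recurrence is run upwards from index 0; the factor [z ^+ e.+1] avoids dividing by [z]. *)
Lemma coef_divXsubC_low (F : comNzRingType) (A B : {poly F}) (z : F) (e : nat) :
  ('X - z%:P) * B = A -> z ^+ e.+1 * B`_e = - \sum_(j < e.+1) A`_j * z ^+ j.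
Proof.
move=> BA; elim: e => [|e IHe].
  rewrite big_ord1 (mulXsubC_coef _ BA) /= sub0r expr1 expr0 mulr1.
  by rewrite opprK.
rewrite big_ord_recr /= opprD -IHe (mulXsubC_coef _ BA) /=.
by rewrite exprS; ring.
Qed.

(** * Lagrange interpolation at distinct nodes *)

Section Lagrange.
Variables (F : fieldType) (n : nat) (z : 'I_n -> F).
Hypothesis z_inj : injective z.
Let P := \prod_i ('X - (z i)%:P).

Lemma deriv_prod_XsubC i :
  (P^`()).[z i] = \prod_(j | j != i) (z i - z j).
Proof.
rewrite /P (bigD1 i) //= derivM hornerD !hornerM derivXsubC hornerC mul1r.
rewrite hornerXsubC subrr mul0r addr0 horner_prod.
by apply: eq_bigr => j _; rewrite hornerXsubC.
Qed.

Lemma deriv_prod_XsubC_neq0 i : (P^`()).[z i] != 0.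
Proof.
rewrite deriv_prod_XsubC prodf_seq_neq0; apply/allP => j _; apply/implyP => ji.
by rewrite subr_eq0 (inj_eq z_inj) eq_sym.
Qed.

(** The difference of the two sides has size at most [n] and vanishes at the [n] distinct nodes. *)
Lemma sum_lagrange_basis : (0 < n)%N ->
  \sum_i (P^`()).[z i]^-1 *: \prod_(j | j != i) ('X - (z j)%:P) = 1.
Proof.
move=> n_gt0; apply/eqP; rewrite -subr_eq0.
set S := (X in X - 1); apply/negPn/negP => nz.
have: all (root (S - 1)) [seq z i | i : 'I_n].
  apply/allP => _ /mapP[i _ ->]; rewrite rootE hornerD hornerN hornerC.
  rewrite /S horner_sum (bigD1 i) //= [X in _ + X - 1]big1 ?addr0.
    rewrite hornerZ horner_prod; under eq_bigr do rewrite hornerXsubC.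
    by rewrite -deriv_prod_XsubC mulVf ?deriv_prod_XsubC_neq0 // subrr.
  move=> k ki; rewrite hornerZ horner_prod (bigD1 i) 1?eq_sym //=.
  by rewrite hornerXsubC subrr mul0r mulr0.
move/(max_poly_roots nz); rewrite map_inj_uniq ?enum_uniq // => /(_ isT).
rewrite size_map size_enum_ord ltnNge => /negP; apply.
apply: leq_trans (size_polyD _ _) _; rewrite geq_max size_polyN size_poly1 n_gt0.
rewrite andbT; apply: leq_trans (size_sum _ _ _) _; apply/bigmax_leqP => i _.
apply: leq_trans (size_scale_leq _ _) _.
rewrite -(big_enum _ _ (predC1 i)) size_prod_XsubC -cardE cardC1 card_ord.
by rewrite prednK.
Qed.

(** This expresses a coefficient of [H] through the quotients of [P * H] by single linear
    factors. *)
Lemma coef_partial_fraction (H : {poly F}) (e : nat) : (0 < n)%N ->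
  H`_e = \sum_i (P^`()).[z i]^-1 * (H * \prod_(j | j != i) ('X - (z j)%:P))`_e.
Proof.
move=> n_gt0; have := congr1 (fun q => (H * q)`_e) (sum_lagrange_basis n_gt0).
rewrite mulr1 => <-; rewrite mulr_sumr coef_sum.
by apply: eq_bigr => i _; rewrite -scalerAr coefZ.
Qed.

End Lagrange.

(** * A submultiplicative norm on polynomials *)

Section L1Norm.
Variable C : numFieldType.
Implicit Types p q A : {poly C}.

Definition l1norm p := \sum_(i < size p) `|p`_i|.

Lemma l1normE n p : (size p <= n)%N -> l1norm p = \sum_(i < n) `|p`_i|.
Proof.
move=> sp; rewrite /l1norm -(subnKC sp) big_split_ord /= [X in _ + X]big1 ?addr0 //.
by move=> i _; rewrite nth_default ?normr0 // leq_addr.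
Qed.

Lemma l1norm_ge0 p : 0 <= l1norm p.
Proof. exact: sumr_ge0. Qed.

Lemma l1normD p q : l1norm (p + q) <= l1norm p + l1norm q.
Proof.
rewrite (l1normE (size_polyD p q)) (l1normE (leq_maxl _ (size q))).
rewrite (l1normE (leq_maxr (size p) _)) -big_split /=.
by apply: ler_sum => i _; rewrite coefD ler_normD.
Qed.

Lemma l1normZ c p : l1norm (c *: p) = `|c| * l1norm p.
Proof.
rewrite (l1normE (size_scale_leq c p)) mulr_sumr.
by apply: eq_bigr => i _; rewrite coefZ normrM.
Qed.

Lemma l1norm_cons p c : l1norm (p * 'X + c%:P) = l1norm p + `|c|.
Proof.
have sz : (size (p * 'X + c%:P)%R <= (size p).+1)%N.
  rewrite (leq_trans (size_polyD _ _)) // geq_max size_polyC.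
  by rewrite (leq_trans (size_polyMleq _ _)) ?size_polyX ?addn2 //; case: eqP.
rewrite (l1normE sz) big_ord_recl coefD coefMX coefC add0r addrC.
by congr (_ + _); apply: eq_bigr => i _; rewrite coefD coefMX coefC addr0.
Qed.

Lemma l1normM p q : l1norm (p * q) <= l1norm p * l1norm q.
Proof.
elim/poly_ind: p => [|p c IHp]; first by rewrite mul0r /l1norm size_poly0 big_ord0 mul0r.
rewrite l1norm_cons mulrDl mulrAC mul_polyC mulrDl.
rewrite (le_trans (l1normD _ _)) // l1normZ lerD2r.
by rewrite -[X in l1norm X]addr0 -polyC0 l1norm_cons normr0 addr0.
Qed.

Lemma l1normX p m : l1norm (p ^+ m) <= l1norm p ^+ m.
Proof.
elim: m => [|m IHm]; first by rewrite !expr0 /l1norm size_poly1 big_ord1 coef1 normr1.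
by rewrite !exprS (le_trans (l1normM _ _)) // ler_wpM2l ?l1norm_ge0.
Qed.

Lemma l1norm_weighted A a n (c : 'I_n -> C) : (forall j, `|c j| <= 1) ->
  `|\sum_(j < n) A`_(a + j) * c j| <= l1norm A.
Proof.
move=> c1; rewrite (l1normE (leq_maxl (size A) (a + n))).
rewrite -(subnKC (leq_maxr (size A) (a + n))) !big_split_ord /=.
rewrite (le_trans (ler_norm_sum _ _ _)) //.
rewrite -[X in X <= _]addr0 lerD ?sumr_ge0 //.
rewrite -[X in X <= _]add0r lerD ?sumr_ge0 //.
by apply: ler_sum => j _; rewrite normrM ler_piMr.
Qed.

End L1Norm.

(** * The residue identity for large [lam] *)

Section Residues.
Variable C : numFieldType.
Hypothesis geometric_squeeze : forall x y K : C, 0 <= x < 1 ->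
  (forall m, `|y| <= K * x ^+ m) -> y = 0.
Variables (p G : {poly C}) (N r n : nat) (lam : C) (z : 'I_n -> C).
Hypotheses (n_gt0 : (0 < n)%N) (z_inj : injective z) (ltNr : (N < r)%N).
Let P := p - lam *: 'X^r.
Hypothesis P_split : P = \prod_i ('X - (z i)%:P).
Hypothesis lam_large : l1norm p < `|lam|.
Hypothesis moments0 : forall m, (0 < m)%N -> (G * p ^+ m)`_(N + r * m) = 0.

Let lam_neq0 : lam != 0.
Proof. by rewrite -normr_gt0 (le_lt_trans _ lam_large) ?l1norm_ge0. Qed.

Let y := lam^-1 *: p.
(** The expansion of [G / P] in powers of [y / X^r], cut after index [m] and multiplied by
    [X^(r (m + 1))] to make it a polynomial. *)
Let H m := - lam^-1 *: (G * \sum_(i < m.+1) 'X^r ^+ (m - i) * y ^+ i).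

Let H_coef m : (H m)`_(N + r * m) = - G`_N / lam.
Proof.
rewrite /H coefZ mulNr mulNr mulrC; congr (- (_ * _)).
rewrite mulr_sumr coef_sum (eq_bigr (fun i : 'I_m.+1 => (G * y ^+ i)`_(N + r * i))).
  rewrite big_ord_recl muln0 addn0 expr0 mulr1 big1 ?addr0 // => i _.
  by rewrite exprZn -scalerAr coefZ moments0 ?mulr0.
move=> i _; have le_im : (i <= m)%N by rewrite -ltnS.
rewrite mulrCA -exprM coefXnM mulnBr ifN; last by rewrite -leqNgt; nia.
by congr (_`_ _); rewrite subnBA ?leq_mul2l ?le_im ?orbT //; nia.
Qed.

Let P_H m : P * H m = G * ('X^r ^+ m.+1 - y ^+ m.+1).
Proof.
rewrite /H subrXX /= -scalerAr mulrCA scalerAr scalerAl; congr (_ * (_ * _)).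
rewrite /P /y scaleNr -scalerN opprB scalerBr scalerA mulVf //.
by rewrite scale1r.
Qed.

Let theta := l1norm p / `|lam|.

Let Gy_norm m : l1norm (G * y ^+ m) <= l1norm G * theta ^+ m.
Proof.
rewrite (le_trans (l1normM _ _)) // ler_wpM2l ?l1norm_ge0 //.
rewrite (le_trans (l1normX _ _)) // lerXn2r ?nnegrE ?l1norm_ge0 //.
  by rewrite divr_ge0 ?l1norm_ge0.
by rewrite l1normZ normfV mulrC.
Qed.

Let B m i := H m * \prod_(j | j != i) ('X - (z j)%:P).

Let B_eq m i : ('X - (z i)%:P) * B m i = G * ('X^r ^+ m.+1 - y ^+ m.+1).
Proof. by rewrite /B mulrCA -P_H P_split [in RHS](bigD1 i) //= mulrC. Qed.

(* As [N < r], the summand [G X^(r (m + 1))] has no term of degree at most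
   [N + r m], so it contributes only to quotients expanded from the top, which
   is how the roots of modulus less than 1 are treated. *)
Let B_small m i : `|z i| < 1 ->
  `|(B m i)`_(N + r * m) - z i ^+ (r - N.+1) * G.[z i]| <=
  l1norm G * theta ^+ m.+1.
Proof.
move=> zi1; set e := (N + r * m)%N; set d := (r - N.+1)%N.
have e_d : (r * m.+1 = d + e.+1)%N by rewrite /e /d; nia.
pose k := (size (B m i) + size (G * 'X^d)%R)%N.
rewrite (@coef_divXsubC_high _ _ _ _ _ k (B_eq m i)); last first.
  by rewrite /k addnCA leq_addr.
have -> : z i ^+ d * G.[z i] = (G * 'X^d).[z i] by rewrite hornerM hornerXn mulrC.
rewrite (@horner_coef_wide _ k) ?leq_addl // -sumrB.
have GX j : (G * 'X^r ^+ m.+1)`_(e.+1 + j) = (G * 'X^d)`_j.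
  by rewrite -exprM e_d exprD mulrA coefMXn ltnNge leq_addr addKn.
under eq_bigr => j _.
  rewrite -mulrBl mulrBr coefB GX addrAC subrr add0r.
  over.
rewrite -normrN -sumrN; under eq_bigr do rewrite mulNr opprK.
rewrite (le_trans (l1norm_weighted _ _ _)) // => j.
by rewrite normrX exprn_ile1 // ltW.
Qed.

(** Here the quotient is expanded from the bottom. With [e = N + r m], the weights [z^(j - e - 1)]
    have modulus at most 1, and [G X^(r (m + 1))] starts above degree [e]. *)
Let B_large m i : ~~ (`|z i| < 1) ->
  `|(B m i)`_(N + r * m)| <= l1norm G * theta ^+ m.+1.
Proof.
move=> zi1; set e := (N + r * m)%N.
have {}zi1 : 1 <= `|z i| by rewrite real_leNgt ?normr_real ?real1.
have zi0 : z i != 0 by rewrite -normr_gt0 (lt_le_trans ltr01).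
rewrite -[X in `|X|](mulKf (expf_neq0 e.+1 zi0)) (coef_divXsubC_low _ (B_eq m i)).
rewrite mulrN normrN mulr_sumr.
under eq_bigr => j _.
  rewrite mulrBr coefB -exprM coefMXn (leq_trans (ltn_ord j)); last first.
    by rewrite /e; nia.
  rewrite sub0r mulNr mulrN mulrCA.
  over.
rewrite sumrN normrN -[X in `|X|]/(\sum_(j < e.+1) (G * y ^+ m.+1)`_(0 + j) * _).
rewrite (le_trans (l1norm_weighted _ _ _)) // => j.
rewrite normrM normfV !normrX mulrC ler_pdivrMr ?mul1r ?exprn_gt0 ?normr_gt0 //.
by rewrite ler_weXn2l // ltnW.
Qed.

(** For every [m], the left side is the coefficient of [H m] of index [N + r m]. Its partial
    fractions differ from the right side by at most a constant times [theta ^+ m]. *)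
Lemma residue_identity :
  - G`_N / lam =
  \sum_(i | `|z i| < 1) (P^`()).[z i]^-1 * (z i ^+ (r - N.+1) * G.[z i]).
Proof.
pose c i := (P^`()).[z i]^-1.
apply/eqP; rewrite -subr_eq0; apply/eqP.
apply: (geometric_squeeze (x := theta) (K := (\sum_i `|c i|) * l1norm G * theta)).
  rewrite divr_ge0 ?l1norm_ge0 //= ltr_pdivrMr ?mul1r //.
  by rewrite normr_gt0.
move=> m; rewrite -(H_coef m) (coef_partial_fraction z_inj) // -P_split.
rewrite [X in _ - X]big_mkcond -sumrB (le_trans (ler_norm_sum _ _ _)) //.
rewrite -[_ * theta * _]mulrA -exprS -mulrA mulr_suml; apply: ler_sum => i _.
case: ifPn => zi1; first by rewrite -mulrBr normrM ler_wpM2l // B_small.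
by rewrite subr0 normrM ler_wpM2l // B_large.
Qed.

End Residues.

(** * Elimination on the curve [p z = lam z^r] *)

Section CurveElimination.
Variables (C : numClosedFieldType) (p : {poly C}) (r : nat).
Implicit Types (z lam : C) (kappa : {poly C}).

(* On the curve [p z = lam z^r], [z - x] divides [lam x^r - p x], which is a
   polynomial in [lam] alone. *)
Lemma curve_elim kappa : kappa != 0 ->
  (forall z, root kappa z -> p.[z] != 0) ->
  exists (D : {poly C}) (B : {poly {poly C}}), D.[0] != 0 /\
    forall lam z, p.[z] = lam * z ^+ r ->
      kappa.[z] * B.[z%:P].[lam] = D.[lam].
Proof.
move=> nz_kappa.
have [s ->] := closed_field_poly_normal kappa.
have : lead_coef kappa != 0 by rewrite lead_coef_eq0.
move: (lead_coef kappa) => c nz_c.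
under [X in X -> _]eq_forall do rewrite rootZ // root_prod_XsubC.
elim: s => [|x s IHs] px.
  exists c%:P, 1; split=> [|lam z _]; first by rewrite hornerC.
  by rewrite big_nil !hornerE.
have [z zs|D [B [D0 DB]]] := IHs; first by rewrite px // inE zs orbT.
have /factor_theorem[b0 b0E] : root (p - p.[x]%:P) x.
  by rewrite rootE !hornerE subrr.
have /factor_theorem[b1 b1E] : root ('X^r - (x ^+ r)%:P) x.
  by rewrite rootE !hornerE subrr.
exists (D * (x ^+ r *: 'X - p.[x]%:P)), (B * (b0^:P - 'X%:P * b1^:P)); split.
  by rewrite !hornerE mulf_neq0 //= oppr_eq0 px ?inE ?eqxx.
move=> lam z curve; have := DB _ _ curve.
rewrite big_cons !hornerE /= => <-.
have -> : b0^:P.[z%:P] = b0.[z]%:P by rewrite horner_map.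
have -> : b1^:P.[z%:P] = b1.[z]%:P by rewrite horner_map.
rewrite !hornerE.
have := congr1 (horner^~ z) b0E; have := congr1 (horner^~ z) b1E.
rewrite !hornerE /= curve => e1 e0.
have -> : x ^+ r * lam - p.[x] = b0.[z] * (z - x) - lam * (b1.[z] * (z - x)).
  by rewrite -e0 -e1; ring.
by ring.
Qed.

Hypotheses (p0 : p.[0] != 0) (r_gt0 : (0 < r)%N).
Let k := 'X * p^`() - p *+ r.

Let nz_p : p != 0.
Proof. by apply: contraNneq p0 => ->; rewrite horner0. Qed.

Lemma euler_op_neq0 : k != 0.
Proof.
apply/eqP => /(congr1 (horner^~ 0)) /eqP.
by rewrite /k !hornerE ?hornerMn oppr_eq0 mulrn_eq0 (negPf p0) gtn_eqF.
Qed.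

Let root_neq0 z : root p z -> z != 0.
Proof. by apply: contraTneq => ->; rewrite rootE. Qed.

(** At a root of [p], which is non-zero, [k] vanishes to order exactly one less than [p], so the gcd
    cannot absorb the full multiplicity. *)
Lemma root_div_gcdp z : root p z -> root (p %/ gcdp p k) z.
Proof.
move=> pz; apply/negPn/negP => rho_z.
have [m [q]] := multiplicity_XsubC p z; rewrite nz_p /= => qz pE.
case: m pE => [|m] pE.
  by move: pz; rewrite pE expr0 mulr1 (negPf qz).
have cop : coprimep (('X - z%:P) ^+ m.+1) (p %/ gcdp p k).
  by apply: coprimep_expl; rewrite coprimep_sym coprimep_XsubC.
have dvd_d : ('X - z%:P) ^+ m.+1 %| gcdp p k.
  by rewrite -(Gauss_dvdpl _ cop) mulrC divpK ?dvdp_gcdl // pE dvdp_mull.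
have : ('X - z%:P) ^+ m.+1 %| k by apply: dvdp_trans dvd_d (dvdp_gcdr _ _).
have -> : k = ('X * q^`() - q *+ r) * ('X - z%:P) ^+ m.+1
              + ('X * q *+ m.+1) * ('X - z%:P) ^+ m.
  rewrite /k pE derivM deriv_exp derivXsubC /= mul1r exprS.
  by move: ('X - _) => u; ring.
rewrite dvdp_addr; last exact: dvdp_mull.
rewrite exprS dvdp_mul2r; last first.
  by rewrite expf_neq0 ?polyXsubC_eq0.
rewrite dvdp_XsubCl rootE !(hornerE, hornerMn) mulrn_eq0 mulf_eq0.
by rewrite -[q.[z] == 0]rootE (negPf qz) orbF (negPf (root_neq0 pz)).
Qed.

(* At a simple root [z] of [p - lam X^r], the value of [z p' - r p] is [z]
   times the derivative of [p - lam X^r]. *)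
Lemma residue_elim (N : nat) : (N <= r)%N ->
  exists (D : {poly C}) (W : {poly {poly C}}),
  [/\ D.[0] != 0, forall z, root p z -> W.[z%:P].[0] = 0 &
    forall lam z, p.[z] = lam * z ^+ r ->
      lam * z ^+ (r - N) * D.[lam] = k.[z] * W.[z%:P].[lam]].
Proof.
move=> le_Nr; set d := gcdp p k.
have kE : k %/ d * d = k by rewrite divpK ?dvdp_gcdr.
have pE : p %/ d * d = p by rewrite divpK ?dvdp_gcdl.
(* No root of [p] is a root of [k %/ d], since it is a root of [p %/ d], which is coprime to
   [k %/ d]. The factor ['X^N] completes [z ^+ (r - N)] to [z ^+ r], so that the curve equation
   applies. *)
have [|z|D [B [D0 DB]]] := @curve_elim (k %/ d * 'X^N).
- rewrite mulf_neq0 //; last by rewrite monic_neq0 ?monicXn.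
  by apply: contraNneq euler_op_neq0 => e; rewrite -kE e mul0r.
- rewrite rootM => /orP[kz|]; last first.
    rewrite rootE hornerXn expf_eq0 => /andP[_ /eqP ->]; exact: p0.
  apply/negP => pz; have /root_div_gcdp := pz => rho_z.
  have cop : coprimep (p %/ d) (k %/ d) by rewrite coprimep_div_gcd // nz_p.
  by have := coprimep_root cop rho_z; rewrite -rootE kz.
exists D, ((p %/ d)^:P * B); split=> // [z pz|lam z curve].
  rewrite !hornerM horner_map /= hornerC.
  by have /rootP -> := root_div_gcdp pz; rewrite mul0r.
have := DB lam z curve => <-; rewrite -[in RHS]kE !hornerM horner_map /= hornerC.
rewrite hornerXn.
have -> : lam * z ^+ (r - N) * ((k %/ d).[z] * z ^+ N * B.[z%:P].[lam]) =
  (lam * (z ^+ (r - N) * z ^+ N)) * ((k %/ d).[z] * B.[z%:P].[lam]) by ring.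
rewrite -exprD subnK // -curve -[in LHS]pE hornerM; ring.
Qed.

End CurveElimination.

(** * Products over subsets of roots as polynomials in the parameter *)

Section SubsetSums.
Variables (F : fieldType) (n : nat) (P W : {poly {poly F}}) (E : {poly F}).

Let w i : {mpoly {poly F}[n]} := (map_poly (@mpolyC n _) W).['X_i].
Let Psi : {mpoly {poly F}[n]} :=
  \prod_(S : {set 'I_n}) (E%:MP_[n] - \sum_(i in S) w i).

Let Psi_sym : Psi \is symmetric.
Proof.
apply/issymP => s.
have msymC (c : {poly F}) : msym s c%:MP_[n] = c%:MP_[n] by rewrite /msym mmapC.
have msymw i : msym s (w i) = w (s i).
  rewrite /w -horner_map /= /msym mmapX mmap1U -map_poly_comp.
  by congr (_.[_]); apply: eq_map_poly => c /=; exact: msymC.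
rewrite rmorph_prod /= [RHS](reindex_inj (imset_inj (@perm_inj _ s))) /=.
apply: eq_bigr => S _; rewrite rmorphB /= msymC rmorph_sum /=.
rewrite big_imset /=; last by move=> i j _ _; apply: perm_inj.
by congr (_ - _); apply: eq_bigr => i _; rewrite msymw.
Qed.

(** The symmetric [Psi] is a polynomial in the elementary symmetric polynomials, whose values at the
    roots are, up to sign, coefficients of [P] and so polynomials in [lam]. *)
Lemma subset_sum_polynomial : exists tau : {poly F}, forall lam (z : 'I_n -> F),
  map_poly (horner_eval lam) P = \prod_i ('X - (z i)%:P) ->
  tau.[lam] = \prod_(S : {set 'I_n})
    (E.[lam] - \sum_(i in S) W.[(z i)%:P].[lam]).
Proof.
have [t [tPsi _]] := sym_fundamental Psi_sym.
pose e i : {poly F} := (-1) ^+ i.+1 * P`_(n - i.+1).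
exists (t.@[fun i : 'I_n => e i]) => lam z Pz.
pose ev := mmap (horner_eval lam) z.
have ev_mesym (i : 'I_n) : ev (mesym n {poly F} i.+1) = (e i).[lam].
  have := mroots_coeff [tuple z j | j < n] (Ordinal (ltn_ord i : i.+1 < n.+1)%N).
  rewrite big_tuple /=; under eq_bigr do rewrite tnth_mktuple.
  rewrite -Pz coef_map /= /e hornerM horner_exp hornerN hornerC.
  rewrite /horner_eval => ->; rewrite mulrA -expr2 -exprM mulnC exprM sqrrN.
  rewrite !expr1n mul1r /ev !mesymE !raddf_sum /=.
  apply: eq_bigr => h _; rewrite mmapX mevalX; apply: eq_bigr => j _.
  by rewrite tnth_mktuple.
have ev_w i : ev (w i) = W.[(z i)%:P].[lam].
  rewrite /w /ev -(horner_map (mmap (horner_eval lam) z)) /= -map_poly_comp.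
  rewrite mmapX mmap1U -/(horner_eval lam W.[(z i)%:P]) -horner_map.
  rewrite /= {3}/horner_eval hornerC; congr (_.[_]).
  by apply: eq_map_poly => c /=; rewrite mmapC.
have -> : \prod_(S : {set 'I_n}) (E.[lam] - \sum_(i in S) W.[(z i)%:P].[lam]) = ev Psi.
  rewrite /Psi /ev rmorph_prod; apply: eq_bigr => S _.
  rewrite rmorphB /= mmapC rmorph_sum /=; congr (_ - _).
  by apply: eq_bigr => i _; rewrite -ev_w.
rewrite -tPsi comp_mpolyE mevalE horner_sum /ev rmorph_sum /=.
apply: eq_bigr => m _; rewrite mmapZ /= hornerM; congr (_ * _).
rewrite horner_prod rmorph_prod /=; apply: eq_bigr => i _.
by rewrite tnth_mktuple rmorphXn /= horner_exp -ev_mesym.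
Qed.

End SubsetSums.

(** * Vanishing moments of powers of a polynomial *)

Lemma poly_eq0_large (C : numFieldType) (q : {poly C}) (K : C) : 0 <= K ->
  (forall x, K < `|x| -> q.[x] = 0) -> q = 0.
Proof.
move=> K0 q0; apply/eqP/negPn/negP => nz.
pose s := [seq K + j.+1%:R | j <- iota 0 (size q)].
have : all (root q) s.
  apply/allP => _ /mapP[j _ ->]; apply/rootP/q0.
  by rewrite ger0_norm ?addr_ge0 ?ler0n // ltrDl ltr0n.
move/(max_poly_roots nz); rewrite map_inj_uniq ?iota_uniq => [/(_ isT)|i j].
  by rewrite size_map size_iota ltnn.
by move/addrI/eqP; rewrite eqr_nat eqSS => /eqP.
Qed.

Lemma monic_split (C : numClosedFieldType) (q : {poly C}) n :
  q \is monic -> size q = n.+1 ->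
  exists z : 'I_n -> C, q = \prod_i ('X - (z i)%:P).
Proof.
have [s ->] := closed_field_poly_normal q => /monicP.
rewrite lead_coefZ (monicP (monic_prod_XsubC _ _ _)) mulr1 => ->.
rewrite scale1r size_prod_XsubC => -[<-].
by exists (fun i => s`_i); rewrite (big_nth 0) big_mkord.
Qed.

(* Only the [i = 0] term of the binomial expansion survives. *)
Lemma moments_binomial (F : comNzRingType) (p G : {poly F}) (N r : nat) (c : F) :
  (forall m, (0 < m)%N -> (G * p ^+ m)`_(N + r * m) = 0) ->
  forall K, (G * ('X^r - c *: p) ^+ K)`_(N + r * K) = G`_N.
Proof.
move=> moments0 K; rewrite exprBn mulr_sumr coef_sum big_ord_recl /=.
rewrite subn0 mulr1 expr0 mul1r bin0 mulr1n -exprM coefMXn ltnNge leq_addl /= addnK.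
rewrite big1 ?addr0 // => i _; rewrite mulrnAr coefMn.
have: (0 < bump 0 i <= K)%N by rewrite /bump /= add1n ltn_ord.
move: (bump 0 i) => j /andP[j_gt0 le_jK].
rewrite [_ * 'X^r ^+ _]mulrC -mulrA mulrCA -exprM coefXnM ifN; last first.
  by rewrite -leqNgt; nia.
have -> : (N + r * K - r * (K - j) = N + r * j)%N by nia.
rewrite -(rmorph_sign (@polyC F)) mul_polyC exprZn -!scalerAr !coefZ moments0 //.
by rewrite !mulr0 mul0rn.
Qed.

Section Moments.
Variable C : numClosedFieldType.
Hypothesis geometric_squeeze : forall x y K : C, 0 <= x < 1 ->
  (forall m, `|y| <= K * x ^+ m) -> y = 0.

Lemma monic_moments_eq0 (p G : {poly C}) (N r n : nat) :
  p \is monic -> size p = n.+1 -> p.[0] != 0 -> (N < r < n)%N ->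
  (forall m, (0 < m)%N -> (G * p ^+ m)`_(N + r * m) = 0) -> G`_N = 0.
Proof.
move=> p_mon sp p0 /andP[ltNr ltrn] moments0.
have r_gt0 : (0 < r)%N by apply: leq_ltn_trans ltNr.
have n_gt0 : (0 < n)%N by apply: ltn_trans ltrn.
pose k := 'X * p^`() - p *+ r.
have [D [W [D0 W0 DW]]] := residue_elim p0 r_gt0 (ltnW ltNr).
have [tau tauE] := subset_sum_polynomial n (p^:P - 'X%:P * 'X^r) (W * G^:P)
  (- G`_N *: D).
have mapE lam : map_poly (horner_eval lam) (p^:P - 'X%:P * 'X^r) = p - lam *: 'X^r.
  apply/polyP => i; rewrite coef_map coefB coef_map coefCM coefXn /= /horner_eval.
  by rewrite !(hornerE, hornerMn) coefB coefZ coefXn.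
have split lam : exists z : 'I_n -> C, p - lam *: 'X^r = \prod_i ('X - (z i)%:P).
  have sX : (size (- (lam *: 'X^r : {poly C})) < size p)%N.
    by rewrite size_polyN (leq_ltn_trans (size_scale_leq _ _)) // size_polyXn sp ltnS.
  apply: monic_split; last by rewrite size_polyDl.
  by rewrite monicE lead_coefDl // -monicE.
have [s kE] : {s | k = lead_coef k *: \prod_(x <- s) ('X - x%:P)}.
  exact: closed_field_poly_normal.
have nz_k : k != 0 := euler_op_neq0 p0 r_gt0.
have ks x : root k x = (x \in s).
  by rewrite kE rootZ ?lead_coef_eq0 // root_prod_XsubC.
have k_0 : ~~ root k 0.
  rewrite rootE /k !hornerE ?hornerMn.
  by rewrite oppr_eq0 mulrn_eq0 (negPf p0) gtn_eqF.
(* [Dl] vanishes at each [lam] for which some root [x] of [k] satisfies [p x = lam x^r]; for all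
   other [lam] the roots [z i] below are distinct. *)
pose Dl := \prod_(x <- s) (x ^+ r *: 'X - p.[x]%:P).
have nz_Dl : Dl != 0.
  rewrite prodf_seq_neq0; apply/allP => x xs /=.
  have nz_x : x != 0 by apply: contraNneq k_0 => <-; rewrite ks.
  apply/eqP => /(congr1 (fun q : {poly C} => q`_1)) /eqP.
  by rewrite coefB coefZ coefX coefC coef0 mulr1 subr0 expf_eq0 (negPf nz_x) andbF.
have tau0 : tau = 0.
  apply/eqP; rewrite -[_ == 0](mulIr_eq0 _ (mulIf nz_Dl)); apply/eqP.
  apply: (poly_eq0_large (l1norm_ge0 p)) => lam lam_large.
  have [z Pz] := split lam.
  set P := p - _ in Pz.
  have curve i : p.[z i] = lam * z i ^+ r.
    have /eqP : P.[z i] = 0.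
      by rewrite Pz horner_prod (bigD1 i) //= hornerXsubC subrr mul0r.
    by rewrite /P !hornerE subr_eq0 => /eqP.
  rewrite hornerM.
  have [/existsP[i kz]|/existsPn kz] := boolP [exists i, root k (z i)].
    rewrite [Dl.[_]](_ : _ = 0) ?mulr0 // /Dl horner_prod.
    rewrite (big_rem (z i)) /=; last by rewrite -ks.
    by rewrite !hornerE curve [lam * _]mulrC subrr mul0r.
  have kP i : k.[z i] = z i * P^`().[z i].
    rewrite /k /P derivB derivZ derivXn !(hornerE, hornerMn) curve mulrBr.
    congr (_ - _); rewrite -mulrnAr !mulrnAr; congr (_ *+ _).
    by rewrite mulrCA -exprS prednK.
  have z_inj : injective z.
    move=> i j zij; apply/eqP; apply: contraNT (kz i) => ij.
    rewrite rootE kP Pz deriv_prod_XsubC (bigD1 j) 1?eq_sym //= zij subrr.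
    by rewrite mul0r mulr0.
  (* The factor for the set of roots inside the unit disc vanishes, by the residue identity times
     [lam * D.[lam]]. *)
  rewrite (tauE _ z) ?mapE // (bigD1 (finset (fun i => `|z i| < 1))) //=.
  rewrite -mulrA; apply/eqP; rewrite mulf_eq0; apply/orP; left.
  rewrite subr_eq0; apply/eqP.
  have nz_lam : lam != 0 by rewrite -normr_gt0 (le_lt_trans _ lam_large) ?l1norm_ge0.
  have := residue_identity geometric_squeeze n_gt0 z_inj ltNr Pz lam_large moments0.
  move=> /(congr1 (fun x => x * (lam * D.[lam]))).
  rewrite mulrA divfK // hornerZ => ->.
  rewrite mulr_suml; under [RHS]eq_bigl do rewrite finset.in_set.
  apply: eq_bigr => i _; rewrite !hornerM horner_map /= hornerC.
  have nz_kz : k.[z i] != 0 by rewrite -rootE.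
  apply: (mulfI nz_kz); rewrite [RHS]mulrA -DW //.
  have nz_z : z i != 0 by apply: contraNneq nz_kz => zi0; rewrite kP zi0 mul0r.
  have nz_P : P^`().[z i] != 0 by apply: contraNneq nz_kz => e; rewrite kP e mulr0.
  rewrite kP -(subnSK ltNr) exprS; field.
  exact: nz_P.
have [z Pz] := split 0.
have zroot i : root p (z i).
  move: Pz; rewrite scale0r subr0 => ->.
  by rewrite rootE horner_prod (bigD1 i) //= hornerXsubC subrr mul0r.
have := tauE 0 z; rewrite mapE => /(_ Pz) /esym/eqP.
rewrite tau0 horner0 prodf_seq_eq0 => /hasP[S _ /=].
rewrite big1 => [|i _]; last by rewrite hornerM hornerM W0 // mul0r.
by rewrite subr0 hornerZ mulf_eq0 (negPf D0) orbF oppr_eq0 => /eqP.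
Qed.

Lemma moments_eq0 (p G : {poly C}) (N r M : nat) :
  p.[0] != 0 -> (r <= (size p).-1)%N ->
  (forall m, (M <= m)%N -> (G * p ^+ m)`_(N + r * m) = 0) -> G`_N = 0.
Proof.
(* As [t] exceeds [M], all moments of [q] of positive index vanish; as it exceeds [N], a positive
   [r] gives [N < r * t]. *)
move=> p0 le_r moments0; set t := (N + M).+1.
have nz_p : p != 0 by apply: contraNneq p0 => ->; rewrite horner0.
pose q := ((lead_coef p)^-1 *: p) ^+ t; pose d := ((size p).-1 * t)%N.
have q_mon : q \is monic.
  by rewrite monic_exp // monicE lead_coefZ mulVf ?lead_coef_eq0.
have q0 : q.[0] != 0.
  by rewrite /q horner_exp hornerZ expf_neq0 // mulf_neq0 // invr_eq0 lead_coef_eq0.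
have sq : size q = d.+1.
  rewrite -[size q]prednK ?size_poly_gt0 ?monic_neq0 // size_exp.
  by rewrite size_scale // invr_eq0 lead_coef_eq0.
have {}moments0 m : (0 < m)%N -> (G * q ^+ m)`_(N + r * t * m) = 0.
  move=> m_gt0; rewrite /q -exprM exprZn -scalerAr coefZ -mulnA moments0 ?mulr0 //.
  by rewrite /t; nia.
clearbody q.
have le_rd : (r * t <= d)%N by rewrite leq_mul2r le_r orbT.
have [r0|r_gt0] := posnP r.
  (* With [r = 0], the polynomial [1 - q / q.[0]] is divisible by [X], so its power [N + 1] has no
     term of degree [N]. *)
  have /factor_theorem[b bE] : root ('X^(r * t) - (q.[0])^-1 *: q) 0.
    by rewrite rootE r0 mul0n expr0 !hornerE mulVf ?subrr //.
  rewrite -(moments_binomial (q.[0])^-1 moments0 N.+1) bE subr0.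
  by rewrite r0 !mul0n addn0 exprMn mulrA coefMXn ltnSn.
have [rd|ltrd] := eqVneq r (size p).-1.
  (* The leading terms cancel in ['X^(r * t) - q], so each factor loses a degree; [(size G).+1]
     factors outweigh the degree of [G]. *)
  rewrite -(moments_binomial 1 moments0 (size G).+1) scale1r nth_default //.
  have d_gt0 : (0 < r * t)%N by rewrite muln_gt0 r_gt0.
  have sd : (size ('X^(r * t) - q)%R <= r * t)%N.
    apply/leq_sizeP => j; rewrite leq_eqVlt coefB coefXn => /predU1P[<-|lt_j].
      by rewrite eqxx rd -/d -[q`_d]/(q`_d.+1.-1) -sq -lead_coefE (monicP q_mon) subrr.
    by rewrite gtn_eqF // sub0r nth_default ?oppr0 // sq /d -rd.
  have arith a b e g R : (0 < R)%N -> (e <= R)%N -> (b <= (e.-1 * g.+1).+1)%N ->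
      (a <= (g + b).-1)%N -> (a <= N + R * g.+1)%N by nia.
  exact: arith d_gt0 sd (size_poly_exp_leq _ _) (size_polyMleq _ _).
apply: (@monic_moments_eq0 q G N (r * t) d) => //.
rewrite [X in _ && X]ltn_mul2r [X in _ && (_ && X)]ltn_neqAle ltrd le_r !andbT.
by rewrite /t; nia.
Qed.

End Moments.

(** * Geometric decay over the real and complex numbers *)

Lemma geometric_squeeze_real (R : archiRealFieldType) (x y K : R) : 0 <= x < 1 ->
  (forall m, y <= K * x ^+ m) -> y <= 0.
Proof.
move=> /andP[x0 x1] yK; rewrite leNgt; apply/negP => y0.
have h0 : 0 < 1 - x by rewrite subr_gt0.
(* Bernoulli's inequality yields [y * (1 + m * (1 - x)) <= K] for all [m], against the Archimedean
   property. *)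
have bernoulli m : x ^+ m * (1 + m%:R * (1 - x)) <= 1.
  elim: m => [|m IHm]; first by rewrite expr0 mul0r addr0 mulr1.
  rewrite (le_trans _ IHm) // exprS -mulrA mulrCA ler_wpM2l ?exprn_ge0 //.
  rewrite -subr_ge0 -natr1.
  have -> : 1 + m%:R * (1 - x) - x * (1 + (m%:R + 1) * (1 - x)) =
    (m%:R + 1) * (1 - x) ^+ 2 :> R by ring.
  by rewrite mulr_ge0 ?sqr_ge0 // addr_ge0 ?ler0n.
have K0 : 0 < K by rewrite (lt_le_trans y0) // (le_trans (yK 0%N)) // mulr1.
have /archi_boundP : 0 <= K / (y * (1 - x)) by rewrite divr_ge0 ?mulr_ge0 // ltW.
set m := Num.bound _.
rewrite ltr_pdivrMr ?mulr_gt0 // => lt_m.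
have le1 : y * (1 + m%:R * (1 - x)) <= K.
  rewrite (le_trans (ler_wpM2r _ (yK m))) ?addr_ge0 ?mulr_ge0 ?ler0n ?(ltW h0) //.
  by rewrite -mulrA ler_piMr ?(ltW K0).
have eqy : y * (1 + m%:R * (1 - x)) = y + m%:R * (y * (1 - x)) by ring.
by move: le1; rewrite eqy leNgt => /negP[]; rewrite (lt_le_trans lt_m) // lerDr ltW.
Qed.

(** Provides the hypothesis [geometric_squeeze] of the sections over abstract fields. The order on
    [R[i]] makes [x] real, and the real part of [K] suffices as constant. *)
Lemma geometric_squeeze_complex (R : realType) (x y K : R[i]) : 0 <= x < 1 ->
  (forall m, `|y| <= K * x ^+ m) -> y = 0.
Proof.
case: x => [x1 x2] /andP[]; rewrite !lecE ltcE /= => /andP[/eqP -> x10] /andP[_ x11].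
move=> yK; apply/eqP; rewrite -normr_eq0 eq_le normr_ge0 andbT.
have xE m : (x1 +i* 0)%C ^+ m = (x1 ^+ m)%:C%C by rewrite rmorphXn.
case: K yK => k1 k2 yK.
have [v yR] : exists v : R, `|y| = v%:C%C by eexists; rewrite normc_def.
rewrite yR -[0]/(0%:C%C) lecR; apply: (@geometric_squeeze_real _ x1 _ k1).
  by rewrite x10.
move=> m; have := yK m; rewrite xE yR lecE /= => /andP[_].
by rewrite !mulr0 subr0.
Qed.

(** * Passage from Laurent polynomials to polynomials *)

Section LaurentTransfer.
Variable F : fieldType.
Local Notation toL := (horner_alg (laurentXn F 1)).
Implicit Types (f : laurent F) (p q : {poly F}) (n : int).

Lemma toL_Xn (m : nat) : toL 'X^m = 'X^[m%:Z].
Proof.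
rewrite rmorphXn /= horner_algX.
by elim: m => [|m IHm]; rewrite ?expr0 // exprS IHm -laurentXnD.
Qed.

Lemma laurentXnX n m : 'X^[n] ^+ m = 'X^[n * m%:Z] :> laurent F.
Proof.
elim: m => [|m IHm]; first by rewrite mulr0 expr0.
by rewrite exprS IHm -laurentXnD; congr 'X^[_]; lia.
Qed.

Lemma laurent_poly f : exists (r : int) p, f = 'X^[- r] * toL p.
Proof.
have [s [c ->]] : exists (s : seq int) (c : int -> F), f = \sum_(n <- s) c n *: 'X^[n].
  by eexists; eexists; exact: laurentE.
have [a bnd] : exists a : nat, forall n, n \in s -> - a%:Z <= n.
  elim: s => [|n s [a IHs]]; first by exists 0%N.
  exists (a + `|n|)%N => k; rewrite inE => /predU1P[->|/IHs]; lia.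
exists a%:Z, (\sum_(n <- s) c n *: 'X^(`|n + a%:Z|)).
rewrite linear_sum mulr_sumr !big_seq; apply: eq_bigr => n /bnd le_an.
rewrite linearZ /= toL_Xn mulr_algl -scalerAr -laurentXnD.
by congr (_ *: 'X^[_]); lia.
Qed.

(** The power of [X] dividing [p] is moved into the monomial, so [r] can have either sign. *)
Lemma laurent_poly_neq0 f : f != 0 ->
  exists (r : int) p, p.[0] != 0 /\ f = 'X^[- r] * toL p.
Proof.
move=> nz_f; have [a [p fE]] := laurent_poly f.
have nz_p : p != 0 by apply: contraNneq nz_f => p0; rewrite fE p0 rmorph0 mulr0.
have [m [q]] := multiplicity_XsubC p 0; rewrite nz_p subr0 /= => q0 pE.
exists (a - m%:Z), q; split; first by rewrite -rootE.
rewrite fE pE rmorphM /= toL_Xn mulrCA -laurentXnD mulrC.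
by congr (_ * _); congr 'X^[_]; lia.
Qed.

Variables (L : {scalar laurent F}) (N : nat).
Hypothesis L_supp : forall n, (N%:Z <= n) || (n <= - N%:Z) -> L 'X^[n] = 0.

(** The exponents decrease as the index grows, so that applying [L] becomes a convolution, that is,
    a coefficient of a product. *)
Definition symbol : {poly F} := \poly_(i < (N + N).+1) L 'X^[N%:Z - i%:Z].

Let L_poly (e : int) p : L ('X^[- e] * toL p) =
  \sum_(k < size p) p`_k * L 'X^[k%:Z - e].
Proof.
rewrite -{1}[p]coefK poly_def [horner_alg _ _]linear_sum mulr_sumr linear_sum.
apply: eq_bigr => k _; rewrite linearZ /= mulr_algl -scalerAr linearZ.
by rewrite toL_Xn -laurentXnD addrC.
Qed.

Lemma L_coef (e : int) (j : nat) p : j%:Z = N%:Z + e ->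
  L ('X^[- e] * toL p) = (symbol * p)`_j.
Proof.
move=> je; rewrite L_poly -[p in RHS]coefK poly_def mulr_sumr coef_sum.
apply: eq_bigr => k _; rewrite -scalerAr coefZ coefMXn coef_poly.
case: ltnP => [lt_jk|le_kj]; first by rewrite L_supp ?mulr0 //; lia.
case: ltnP => [_|lt_N]; last by rewrite L_supp ?mulr0 //; lia.
by congr (_ * L 'X^[_]); lia.
Qed.

Lemma L_low (e : int) p : N%:Z + e < 0 -> L ('X^[- e] * toL p) = 0.
Proof. by move=> Ne; rewrite L_poly big1 // => k _; rewrite L_supp ?mulr0 //; lia. Qed.

Lemma symbol_coef : symbol`_N = L 1.
Proof. by rewrite coef_poly ltnS leq_addr subrr. Qed.

End LaurentTransfer.

(** * From the radical to the strong radical *)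

Section MathieuZhao.
Variables (C : numClosedFieldType) (L : {scalar laurent C}) (N : nat).
Local Notation toL := (horner_alg (laurentXn C 1)).
Hypothesis geometric_squeeze : forall x y K : C, 0 <= x < 1 ->
  (forall m, `|y| <= K * x ^+ m) -> y = 0.
Hypothesis L_supp : forall n : int, (N%:Z <= n) || (n <= - N%:Z) -> L 'X^[n] = 0.
Hypothesis L1 : L 1 != 0.

Lemma radical_strong_radical (a b : laurent C) (M : nat) :
  (forall m, (M <= m)%N -> L (a ^+ m) = 0) ->
  exists2 M' : nat, (1 <= M')%N & forall m, (M' <= m)%N -> L (b * a ^+ m) = 0.
Proof.
move=> La0; have [->|nz_a] := eqVneq a 0.
  by exists 1%N => // m m_gt0; rewrite expr0n gtn_eqF // mulr0 linear0.
have [r [p [p0 aE]]] := laurent_poly_neq0 nz_a.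
have aXE m : a ^+ m = 'X^[- (r * m%:Z)] * toL (p ^+ m).
  rewrite aE exprMn laurentXnX -rmorphXn; congr ('X^[_] * _); lia.
have [s [q bE]] := laurent_poly b.
have bXE m : b * a ^+ m = 'X^[- (s + r * m%:Z)] * toL (q * p ^+ m).
  rewrite bE aXE rmorphM mulrACA -laurentXnD; congr ('X^[_] * _); lia.
have [r_lt0|r_ge0] := ltP r 0.
  exists (N + `|s|).+1 => // m le_m; rewrite bXE (L_low L_supp) //; nia.
have [le_r|lt_r] := leqP `|r|%N (size p).-1.
  have [] := negP L1; rewrite -(symbol_coef L N); apply/eqP.
  apply: (moments_eq0 geometric_squeeze p0 le_r (M := M)) => m le_m.
  rewrite -(L_coef L_supp (e := r * m%:Z)); last lia.
  by rewrite -aXE La0.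
(* As [r] exceeds the degree of [p], each increment of [m] raises the index by at least one more
   than the degree bound; [B] and [N + |s|] absorb the constants. *)
pose B := (size (symbol L N) + size q)%N.
exists (N + `|s| + B).+1 => // m le_m.
rewrite bXE (L_coef L_supp (j := `|N%:Z + (s + r * m%:Z)|)); last nia.
rewrite nth_default // mulrA.
have arith x y z : (z <= (y.-1 * m).+1)%N -> (x <= (B + z).-1)%N ->
    (y.-1 < `|r|)%N -> (x <= `|(N%:Z + (s + r * m%:Z))%R|)%N.
  by move=> hz hx hy; nia.
apply: (arith _ (size p) (size (p ^+ m))) lt_r; first exact: size_poly_exp_leq.
rewrite (leq_trans (size_polyMleq _ _)) //.
have := size_polyMleq (symbol L N) q; rewrite /B; lia.
Qed.

End MathieuZhao.

Theorem theorem5 (R : realType) (L : {scalar laurent R[i]})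
    (L_neq0 : exists f : laurent R[i], L f != 0)
    (L_ninj : ~ injective L)
    (L_supp : exists2 N : int, 1 <= N &
       forall n : int, (N <= n) || (n <= - N) -> L 'X^[n] = 0) :
  MZ_space [set f : laurent R[i] | L f = 0] <-> L 1 != 0.
Proof.
split=> [[_ sr_r]|L1].
  apply/negP => /eqP L1; have [f /negP] := L_neq0; apply; apply/eqP.
  (* If [L 1 = 0], then 1 is in the radical, hence in the strong radical, and the multiplier [b = f]
     gives [L f = 0]. *)
  have : radical [set f : laurent R[i] | L f = 0] 1.
    by exists 1%N => // m _; rewrite /= expr1n.
  rewrite -sr_r => /(_ f)[M _ /(_ M (leqnn M))].
  by rewrite /= expr1n mulr1.
split.
  split=> [|a u v]; first by rewrite inE /= linear0.
  by rewrite !inE /= => Lu Lv; rewrite linearP Lu Lv /= mulr0 addr0.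
have [N N_ge1 L0] := L_supp.
have {}L0 n : (`|N|%:Z <= n) || (n <= - `|N|%:Z) -> L 'X^[n] = 0.
  by move=> hn; apply: L0; lia.
apply/seteqP; split=> a /=.
  by move=> /(_ 1)[M M_gt0 Ma]; exists M => // m /Ma; rewrite /= mul1r.
move=> [M _ Ma] b.
exact: (radical_strong_radical (@geometric_squeeze_complex R) L0 L1 b Ma).
Qed.
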